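(* Let $0<\alpha<1$ and let $\Psi:\mathbb{R}^2\to\mathbb{R}$ be a real analytic scalar function invariant under spatial rotation, i.e. $\Psi'(x',y')=\Psi(x,y)$ and $L\Psi=y\,D^1_x\Psi-x\,D^1_y\Psi=0$, where $x'=\cos\phi\,x+\sin\phi\,y$, $y'=-\sin\phi\,x+\cos\phi\,y$. Let ${}^{C}D^\alpha$ denote the Caputo partial fractional derivatives. Then for fixed $x,y>0$, to first order in the rotation angle $\phi$ (i.e. up to $O(\phi^2)$ as $\phi\to0$), $${}^{C}D^\alpha_{x'}\Psi'(x',y')={}^{C}D^\alpha_x\Psi(x,y)+\phi\left(\alpha\,D_x^{\alpha-1}D^1_y\Psi(x,y)+\frac{x^{1-\alpha}\,D^1_y\Psi(0,y)}{\Gamma(1-\alpha)}\right)+O(\phi^2),$$ $${}^{C}D^\alpha_{y'}\Psi'(x',y')={}^{C}D^\alpha_y\Psi(x,y)-\phi\left(\alpha\,D_y^{\alpha-1}D^1_x\Psi(x,y)+\frac{y^{1-\alpha}\,D^1_x\Psi(x,0)}{\Gamma(1-\alpha)}\right)+O(\phi^2).$$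
   Context: $D^1_x=\partial/\partial x$, $D^1_y=\partial/\partial y$; $D^1_y\Psi(0,y)$ is $\partial\Psi/\partial y$ evaluated at $(0,y)$, and $D^1_x\Psi(x,0)$ is $\partial\Psi/\partial x$ evaluated at $(x,0)$. For $0<\alpha<1$ the Caputo partial fractional derivatives with lower limit $0$ are $${}^{C}D_x^\alpha f(x,y)=\frac{1}{\Gamma(1-\alpha)}\int_0^x\frac{\partial_u f(u,y)\,du}{(x-u)^{\alpha}},\qquad {}^{C}D_y^\alpha f(x,y)=\frac{1}{\Gamma(1-\alpha)}\int_0^y\frac{\partial_u f(x,u)\,du}{(y-u)^{\alpha}}.$$ Since $\alpha-1<0$, the operators $D_x^{\alpha-1}$, $D_y^{\alpha-1}$ are Riemann-Liouville fractional integrals: $$D_x^{\alpha-1} f(x,y)=\frac{1}{\Gamma(1-\alpha)}\int_0^x\frac{f(u,y)\,du}{(x-u)^{\alpha}},\qquad D_y^{\alpha-1} f(x,y)=\frac{1}{\Gamma(1-\alpha)}\int_0^y\frac{f(x,u)\,du}{(y-u)^{\alpha}}.$$ The dependence of $\Psi$ on the rotation angle comes only through its arguments, so that $\Psi'$ as a function of its two arguments is the same function as $\Psi$, and ${}^{C}D^\alpha_{x'}\Psi'(x',y')$ (resp. ${}^{C}D^\alpha_{y'}\Psi'(x',y')$) is the Caputo derivative of $\Psi'$ in its first (resp. second) argument, evaluated at $(x',y')$. *)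

(* Defs.v *)
From mathcomp Require Import all_boot all_order all_algebra.
From mathcomp Require Import all_classical all_reals all_analysis.

Set Implicit Arguments.
Unset Strict Implicit.
Unset Printing Implicit Defensive.

Import Order.TTheory GRing.Theory Num.Theory.
Import numFieldNormedType.Exports.

Local Open Scope classical_set_scope.
Local Open Scope ring_scope.

(* Joint real analyticity on the whole plane. The double series is summed along
   the diagonals i + j = n; as its absolute convergence is also required, the
   order of summation is immaterial. *)
Definition real_analytic2 (R : realType) (f : R -> R -> R) : Prop :=
  forall a b : R, exists c : nat -> nat -> R, exists r : R, 0 < r /\
    forall x y : R, `|x - a| < r -> `|y - b| < r ->
      let t i j := c i j * (x - a) ^+ i * (y - b) ^+ j in
      cvgn (series (fun n => \sum_(i < n.+1) `|t i (n - i)%N|)) /\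
      (series (fun n => \sum_(i < n.+1) t i (n - i)%N) n @[n --> \oo]
         --> f x y).

Definition partial_x (R : realType) (f : R -> R -> R) (x y : R) : R :=
  derive1 (fun u => f u y) x.

Definition partial_y (R : realType) (f : R -> R -> R) (x y : R) : R :=
  derive1 (fun v => f x v) y.

(* Euler's integral; meaningful for z > 0. *)
Definition Gamma (R : realType) (z : R) : R :=
  \int[@lebesgue_measure R]_(t in `]0, +oo[) (t `^ (z - 1) * expR (- t)).

(* The operators below have lower limit 0 and are meaningful where the upper
   limit is nonnegative. The value of the integrand at the singular endpoint
   (0, because 0^-1 = 0) does not affect the Lebesgue integral. *)

(* Fractional integrals of order 1 - alpha, that is D_x^(alpha - 1) and
   D_y^(alpha - 1). *)
Definition RL_integral_x (R : realType) (alpha : R) (f : R -> R -> R)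
    (x y : R) : R :=
  (Gamma (1 - alpha))^-1 *
    \int[@lebesgue_measure R]_(u in `[0, x]) (f u y / (x - u) `^ alpha).

Definition RL_integral_y (R : realType) (alpha : R) (f : R -> R -> R)
    (x y : R) : R :=
  (Gamma (1 - alpha))^-1 *
    \int[@lebesgue_measure R]_(u in `[0, y]) (f x u / (y - u) `^ alpha).

Definition caputo_x (R : realType) (alpha : R) (f : R -> R -> R)
    (x y : R) : R :=
  (Gamma (1 - alpha))^-1 *
    \int[@lebesgue_measure R]_(u in `[0, x])
      (partial_x f u y / (x - u) `^ alpha).

Definition caputo_y (R : realType) (alpha : R) (f : R -> R -> R)
    (x y : R) : R :=
  (Gamma (1 - alpha))^-1 *
    \int[@lebesgue_measure R]_(u in `[0, y])
      (partial_y f x u / (y - u) `^ alpha).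

Definition rot_x (R : realType) (phi x y : R) : R := cos phi * x + sin phi * y.

Definition rot_y (R : realType) (phi x y : R) : R :=
  - sin phi * x + cos phi * y.

(* The transformed function Psi' coincides with Psi as a function of its two
   arguments, so invariance is stated with Psi alone. *)
Definition rotation_invariant (R : realType) (Psi : R -> R -> R) : Prop :=
  (forall phi x y : R, Psi (rot_x phi x y) (rot_y phi x y) = Psi x y) /\
  (forall x y : R, y * partial_x Psi x y - x * partial_y Psi x y = 0).

(* Main.v *)
Require Import Defs.
From mathcomp Require Import all_boot all_order all_algebra.
From mathcomp Require Import all_classical all_reals all_analysis measurable_realfun.
From mathcomp Require Import ring lra.

Set Implicit Arguments.
Unset Strict Implicit.
Unset Printing Implicit Defensive.

Import Order.TTheory GRing.Theory Num.Theory.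
Import numFieldNormedType.Exports.

Local Open Scope classical_set_scope.
Local Open Scope ring_scope.

(* The restriction of Psi to an axis is a locally convergent power series g, and
   by rotation invariance Psi x y = F (x^2 + y^2) with F s = g (sqrt s), so F is smooth
   on s > 0.  Write f = F'.  Along the rotation, X^2 + Y^2 = rho stays constant, and the
   scaling u = X s turns the Caputo derivative in x into the one-variable expression
     X^(2 - alpha) * int_0^1 2 s f (rho - X^2 (1 - s^2)) / (1 - s)^alpha ds
   up to the factor 1 / Gamma (1 - alpha).  A Taylor expansion of f, uniform in s,
   expands it to first order in X; the resulting linear term is brought to the stated
   form by integrating the derivative of (1 - s)^(1 - alpha) (1 + s) f (y^2 + x^2 s^2).
   The second expansion is the first one for (x, y) |-> Psi y x and the angle - phi. *)

(** * Termwise differentiation of real power series *)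

Section PowerSeries.
Variable R : realType.
Implicit Types (c : nat -> R) (g : R -> R).

(** For [t] in [0, 1) each of the [n + 1] terms [t ^+ i], [i <= n], is at least [t ^+ n], and their
    geometric sum is at most [(1 - t)^-1]. This absorbs the factor [n + 1] created by
    differentiation. *)
Lemma natr_exp_le (t : R) n : 0 <= t < 1 -> n.+1%:R * t ^+ n <= (1 - t)^-1.
Proof.
move=> /andP[t0 t1]; rewrite -[leRHS]mul1r ler_pdivlMr ?subr_gt0//.
apply: (@le_trans _ _ ((\sum_(i < n.+1) t ^+ i) * (1 - t))).
  rewrite ler_pM2r ?subr_gt0// mulr_natl -[X in _ *+ X]card_ord -sumr_const.
  by apply: ler_sum => i _; rewrite ler_wiXn2l// ?(ltW t1)// -ltnS.
by rewrite mulrC -[1 - t]opprB mulNr -subrX1 opprB gerBl exprn_ge0.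
Qed.

(** Convergence at some [K] beyond [|x|] bounds the terms [c n * K ^+ n]; at an intermediate point
    [L] the differentiated series is then dominated by a geometric one. *)
Lemma cvg_pseries_diffs c (r : R) :
  (forall x, `|x| < r -> cvgn (pseries c x)) ->
  forall x, `|x| < r -> cvgn (pseries (pseries_diffs c) x).
Proof.
move=> cc x xr.
pose K := (`|x| + r) / 2.
have K0 : 0 < K by have := normr_ge0 x; rewrite /K; lra.
have xK : `|x| < K by rewrite /K; lra.
have Kr : `|K| < r by rewrite gtr0_norm// /K; lra.
pose L := (`|x| + K) / 2.
have L0 : 0 < L by have := normr_ge0 x; rewrite /L; lra.
have xL : `|x| < L by rewrite /L; lra.
have LK : L < K by rewrite /L; lra.
have [M [Mreal Mf]] := cvg_series_bounded (cc _ Kr).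
apply: (@is_cvg_pseries_inside _ _ L); last by rewrite (gtr0_norm L0).
apply: normed_cvg.
(* The ratio [L / K] is split as [t * q] through the midpoint of [L] and [K]: the powers of [t]
   absorb the factor [n + 1], those of [q] form the dominating series. *)
pose q := (L + K) / 2 / K.
have q0 : 0 < q by rewrite divr_gt0//; lra.
have q1 : q < 1 by rewrite ltr_pdivrMr//; lra.
pose t := L / ((L + K) / 2).
have t0 : 0 <= t by rewrite divr_ge0//; lra.
have t1 : t < 1 by rewrite ltr_pdivrMr; lra.
have tq : t * q = L / K.
  rewrite /t /q; field; apply/andP; split; last by rewrite gt_eqF//; lra.
  by rewrite gt_eqF.
apply: (@series_le_cvg _ _ (geometric ((1 - t)^-1 * `|M + 1| / K) q)) => [n|n|n|].
- exact: normr_ge0.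
- rewrite /geometric /= mulr_ge0 ?exprn_ge0 ?(ltW q0)// divr_ge0 ?(ltW K0)//.
  by rewrite mulr_ge0// invr_ge0; lra.
- have := Mf (M + 1); rewrite ltrDl => /(_ ltr01 n.+1 Logic.I) /= H.
  rewrite /geometric /pseries_diffs /=.
  have -> : n.+1%:R * c n.+1 * L ^+ n =
            (c n.+1 * K ^+ n.+1) * (n.+1%:R * t ^+ n) * q ^+ n / K.
    have -> : L ^+ n = K ^+ n * t ^+ n * q ^+ n.
      by rewrite -!exprMn -mulrA tq mulrCA divff ?mulr1 ?gt_eqF.
    by rewrite exprS; field; rewrite gt_eqF.
  rewrite normrM normfV (gtr0_norm K0) [leRHS]mulrAC ler_pM2r ?invr_gt0//.
  rewrite 2!normrM (ger0_norm (exprn_ge0 _ (ltW q0))) ler_pM2r ?exprn_gt0//.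
  rewrite [leRHS]mulrC ler_pM//; first exact: le_trans H (ler_norm _).
  by rewrite ger0_norm ?mulr_ge0 ?exprn_ge0// natr_exp_le ?t0.
- by apply: is_cvg_geometric_series; rewrite ger0_norm ?(ltW q0).
Qed.

(** The series and its first two termwise derivatives converge at a point [K] strictly between [|x|]
    and [r], which justifies differentiating termwise at [x]. *)
Lemma is_derive_pseries c (r x : R) :
  (forall y, `|y| < r -> cvgn (pseries c y)) -> `|x| < r ->
  is_derive x (1 : R) (fun y => limn (pseries c y))
    (limn (pseries (pseries_diffs c) x)).
Proof.
move=> cc xr; pose K := (`|x| + r) / 2.
have x0 := normr_ge0 x.
have KE : `|K| = K by rewrite ger0_norm// /K; lra.
have Kr : `|K| < r by rewrite KE /K; lra.
have cd := cvg_pseries_diffs cc.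
apply: (@pseries_snd_diffs _ c K); [exact: cc|exact: cd| |].
  exact: (cvg_pseries_diffs cd).
by rewrite KE /K; lra.
Qed.

Definition locally_pseries g :=
  forall a, exists c : nat -> R, exists2 r : R, 0 < r &
    forall x, `|x - a| < r -> pseries c (x - a) @ \oo --> g x.

(** The conclusion gives the hypothesis back for the derivative, so the lemma can be iterated to
    reach any order. *)
Lemma locally_pseries_derive g : locally_pseries g ->
  (forall x : R, is_derive x (1 : R) g (derive1 g x)) /\ locally_pseries (derive1 g).
Proof.
move=> ag.
have key (a : R) : exists c : nat -> R, exists2 r : R, 0 < r &
    forall x : R, `|x - a| < r ->
      cvgn (pseries (pseries_diffs c) (x - a)) /\
      is_derive x (1 : R) g (limn (pseries (pseries_diffs c) (x - a))).
  have [c [r r0 cg]] := ag a; exists c, r => // x xr.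
  have cc y : `|y| < r -> cvgn (pseries c y).
    move=> yr; apply/cvg_ex; exists (g (y + a)).
    by have := cg (y + a); rewrite addrK; apply.
  split; first exact: cvg_pseries_diffs cc _ xr.
  have D := is_derive_pseries cc xr.
  have S : is_derive x (1 : R) (fun y : R => y - a) 1.
    by apply: is_derive_eq; rewrite subr0.
  have := @is_derive1_comp _ (fun y => limn (pseries c y)) (fun y : R => y - a) x _ _ D S.
  rewrite mulr1; apply: near_eq_is_derive.
  near=> y; apply/cvg_lim => //; apply: cg; near: y.
  apply/nbhs_ballP; exists (r - `|x - a|) => /=; first by rewrite subr_gt0.
  move=> y; rewrite /ball /= ltrBrDr; apply: le_lt_trans.
  by rewrite (distrC x y); exact: ler_distD.
split=> [x|a].
  have [c [r r0 cg]] := key x.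
  have [|_ d] := cg x; first by rewrite subrr normr0.
  by rewrite derive1E; apply: DeriveDef => //; apply: ex_derive.
have [c [r r0 cg]] := key a; exists (pseries_diffs c), r => // x xr.
by have [cd d] := cg x xr; rewrite derive1E derive_val.
Unshelve. all: by end_near. Qed.

End PowerSeries.

(** * Rotation-invariant functions as functions of the squared radius *)

Section Radial.
Variable R : realType.
Implicit Types (Psi : R -> R -> R).

(** On the axis [y = 0], centred at [b = 0], the diagonal sum of index [n] keeps only its term
    [i = n], the others carrying a positive power of 0. *)
Lemma real_analytic2_locally_pseries Psi :
  real_analytic2 Psi -> locally_pseries (fun x => Psi x 0).
Proof.
move=> aPsi a; have [c [r [r0 cP]]] := aPsi a 0.
exists (c ^~ 0%N), r => // x xr.
have r00 : `|0 - 0 : R| < r by rewrite subrr normr0.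
have [_] := cP x 0 xr r00.
rewrite (_ : series _ = pseries (c ^~ 0%N) (x - a))//; apply/funext => n; apply: eq_bigr => i _.
rewrite subrr big_ord_recr /= subnn expr0 mulr1 big1 ?add0r// => j _.
by rewrite expr0n subn_eq0 leqNgt ltn_ord mulr0.
Qed.

(** The angle is the polar angle of the point. As the sine of an [acos] is nonnegative, it equals
    [|y| / r], and the sign of [y] decides the sign of the angle. *)
Lemma rotation_to_axis (x y : R) : 0 < x ^+ 2 + y ^+ 2 ->
  exists phi, rot_x phi x y = Num.sqrt (x ^+ 2 + y ^+ 2) /\ rot_y phi x y = 0.
Proof.
move=> s0; set r := Num.sqrt _.
have r0 : 0 < r by rewrite sqrtr_gt0.
have rr : r ^+ 2 = x ^+ 2 + y ^+ 2 by rewrite sqr_sqrtr// ltW.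
have xr : -1 <= x / r <= 1.
  rewrite -ler_norml normrM normfV (gtr0_norm r0) ler_pdivrMr// mul1r.
  by rewrite -sqrtr_sqr ler_wsqrtr// lerDl sqr_ge0.
have sE : sin (acos (x / r)) = `|y| / r.
  rewrite sin_acos// -[RHS]ger0_norm ?divr_ge0 ?(ltW r0)// -sqrtr_sqr; congr Num.sqrt.
  rewrite !expr_div_n -normrX ger0_norm ?sqr_ge0// rr; field.
  by rewrite gt_eqF.
have cE : cos (acos (x / r)) = x / r by rewrite acosK// in_itv.
have rn0 : r != 0 by rewrite gt_eqF.
exists (if 0 <= y then acos (x / r) else - acos (x / r)).
case: ifPn => [y0|]; last rewrite -ltNge => y0;
  rewrite /rot_x /rot_y ?cosN ?sinN cE sE ?(ger0_norm y0) ?(ltr0_norm y0).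
  split; last by field.
  by apply: (mulIf rn0); rewrite -expr2 rr; field.
split; last by field.
by apply: (mulIf rn0); rewrite -expr2 rr; field.
Qed.

(** Everything is asked for [s > 0] only, since the square root is not differentiable at 0; the
    segments of integration avoid the origin. Continuity of the third derivative [f2] of [F] serves
    to bound the second-order Taylor remainder of [f] uniformly on compact intervals. *)
Record radial_profile Psi (F f f1 f2 : R -> R) : Prop := RadialProfile {
  radialE : forall x y, 0 < x ^+ 2 + y ^+ 2 -> Psi x y = F (x ^+ 2 + y ^+ 2);
  derive_profile : forall s : R, 0 < s -> is_derive s (1 : R) F (f s);
  derive_profile1 : forall s : R, 0 < s -> is_derive s (1 : R) f (f1 s);
  derive_profile2 : forall s : R, 0 < s -> is_derive s (1 : R) f1 (f2 s);
  continuous_profile2 : forall s : R, 0 < s -> {for s, continuous f2} }.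

Lemma radial_profile_exists Psi : real_analytic2 Psi -> rotation_invariant Psi ->
  exists F f f1 f2, radial_profile Psi F f f1 f2.
Proof.
move=> aPsi [inv _].
pose g0 x := Psi x 0.
have [d0 a1] := locally_pseries_derive (real_analytic2_locally_pseries aPsi).
have [d1 a2] := locally_pseries_derive a1.
have [d2 a3] := locally_pseries_derive a2.
(* The fourth derivative of [g0] enters only through the continuity of [f2], which is deduced from
   its differentiability. *)
have [d3 _] := locally_pseries_derive a3.
set g1 := derive1 _ in d0 d1; set g2 := derive1 g1 in d1 d2.
set g3 := derive1 g2 in d2 d3; set g4 := derive1 g3 in d3.
(* As i' = -2 i^3, the derivatives of F are polynomials in i with coefficients g_k (sqrt s). *)
pose i (s : R) := (2 * Num.sqrt s)^-1.
have dsqrt (s : R) : 0 < s -> is_derive s (1 : R) Num.sqrt (i s).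
  exact: is_derive1_sqrt.
have di (s : R) : 0 < s -> is_derive s (1 : R) i (- 2 * i s ^+ 3).
  move=> s0; have ds := dsqrt s s0.
  have n0 : 2 * Num.sqrt s != 0 by rewrite mulf_neq0// gt_eqF ?sqrtr_gt0.
  have D : is_derive s (1 : R) (fun u : R => 2 * Num.sqrt u) (2 * i s).
    by apply: is_derive_eq.
  apply: (is_derive_eq (@is_deriveV _ (fun u : R => 2 * Num.sqrt u) s _ 1 n0 D)).
  by rewrite /i /GRing.scale /=; field; rewrite gt_eqF ?sqrtr_gt0.
have da (g g' : R -> R) : (forall x : R, is_derive x (1 : R) g (g' x)) ->
    forall s : R, 0 < s -> is_derive s (1 : R) (fun s => g (Num.sqrt s)) (g' (Num.sqrt s) * i s).
  move=> dg s s0; exact: (is_derive1_comp (dg _) (dsqrt _ s0)).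
pose b1 (s : R) := g1 (Num.sqrt s); pose b2 (s : R) := g2 (Num.sqrt s).
pose b3 (s : R) := g3 (Num.sqrt s).
have db1 s s0 : is_derive s (1 : R) b1 (b2 s * i s) := da _ _ d1 s s0.
have db2 s s0 : is_derive s (1 : R) b2 (b3 s * i s) := da _ _ d2 s s0.
have db3 s s0 : is_derive s (1 : R) b3 (g4 (Num.sqrt s) * i s) := da _ _ d3 s s0.
exists (fun s => g0 (Num.sqrt s)), (fun s => b1 s * i s),
  (fun s => b2 s * i s ^+ 2 - 2 * (b1 s * i s ^+ 3)),
  (fun s => b3 s * i s ^+ 3 - 6 * (b2 s * i s ^+ 4) + 12 * (b1 s * i s ^+ 5)).
split=> [x y s0|s s0|s s0|s s0|s s0].
- by have [phi [xE yE]] := rotation_to_axis s0; rewrite -(inv phi) xE yE.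
- exact: da.
- have := db1 s s0; have := di s s0 => ? ?.
  by apply: is_derive_eq; rewrite /GRing.scale /=; ring.
- have := db1 s s0; have := db2 s s0; have := di s s0 => ? ? ?.
  by apply: is_derive_eq; rewrite /GRing.scale /=; ring.
- have := db1 s s0; have := db2 s s0; have := db3 s s0; have := di s s0 => ? ? ? ?.
  by apply/differentiable_continuous/derivable1_diffP; apply: ex_derive.
Qed.

Lemma radial_profile_swap Psi F f f1 f2 : radial_profile Psi F f f1 f2 ->
  radial_profile (fun u v => Psi v u) F f f1 f2.
Proof. by case=> PE *; split=> // u v uv; rewrite PE addrC// addrC. Qed.

End Radial.

(** * The fundamental theorem of calculus with endpoint singularities *)

Section FTC_integrable.
Variable R : realType.
Notation mu := (@lebesgue_measure R).

Lemma FTC2_integrable (f F : R -> R) (a b : R) : a < b ->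
  mu.-integrable `[a, b] (EFin \o f) ->
  {in `]a, b[, continuous f} ->
  F @ a^'+ --> F a -> F @ b^'- --> F b ->
  (forall x, a < x < b -> is_derive x (1 : R) F (f x)) ->
  \int[mu]_(x in `[a, b]) f x = F b - F a.
Proof.
(* f need not be bounded near a and b: apply the fundamental theorem on [u, v] inside
   ]a, b[ and pass to the limit by continuity of the indefinite integral. *)
move=> ab intf cf Fa Fb dF.
pose G x := \int[mu]_(t in `[a, x]) f t.
have intS u v : a <= u -> v <= b -> mu.-integrable `[u, v] (EFin \o f).
  by move=> au vb; apply: integrableS intf => //; exact: subset_itvScc.
have GF u v : a < u -> u < v -> v < b -> G v - G u = F v - F u.
  move=> au uv vb.
  rewrite /G Rintegral_itvB ?bnd_simp ?(ltW au) ?(ltW uv)//; last first.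
    by apply: intS => //; exact: ltW.
  have cf' : {in `[u, v], continuous f}.
    move=> x /[!in_itv]/= /andP[ux xv]; apply: cf; rewrite in_itv/=.
    by rewrite (lt_le_trans au ux) (le_lt_trans xv vb).
  have dF' x : u <= x <= v -> is_derive x (1 : R) F (f x).
    by move=> /andP[ux xv]; apply: dF; rewrite (lt_le_trans au ux) (le_lt_trans xv vb).
  have cF : {within `[u, v], continuous F}.
    apply: derivable_within_continuous => x /[!in_itv]/= xuv.
    by have := dF' x xuv => ?; exact: ex_derive.
  rewrite Rintegral_itv_obnd_cbnd; last first.
    apply: (integrableS _ _ _ (intS u v _ _)) => //; [|exact: ltW|exact: ltW].
    exact: subset_itv_oc_cc.
  rewrite /Rintegral (@continuous_FTC2 _ f F)//.
  - apply: continuous_in_subspaceT => x; rewrite inE /=; exact: cf'.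
  - have [_ Fu Fv] := (continuous_within_itvP _ uv).1 cF.
    split=> // x /[!in_itv]/= /andP[ux xv].
    have := dF' x; rewrite (ltW ux) (ltW xv) => /(_ isT) ?.
    exact: ex_derive.
  - move=> x /[!in_itv]/= /andP[ux xv].
    have := dF' x; rewrite (ltW ux) (ltW xv) => /(_ isT) ?.
    by rewrite derive1E derive_val.
have cG := parameterized_integral_continuous (ltW ab) intf.
have [_ Ga Gb] := (continuous_within_itvP _ ab).1 cG.
rewrite -/(G b).
have -> : G b = G b - G a by rewrite [G a]/G set_itv1 Rintegral_set1 subr0.
(* [GF] compares increments between interior points only, so each endpoint is reached separately
   from the interior point [m]. *)
pose m := (a + b) / 2.
have am : a < m by rewrite /m; lra.
have mb : m < b by rewrite /m; lra.
have H1 : G b - G m = F b - F m.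
  have A : G v - G m @[v --> b^'-] --> G b - G m.
    by apply: cvgB; [exact: Gb|exact: cvg_cst].
  have B : G v - G m @[v --> b^'-] --> F b - F m.
    apply: (@cvg_trans _ (F v - F m @[v --> b^'-])).
      by apply: near_eq_cvg; near=> v; rewrite /= GF.
    by apply: cvgB; [exact: Fb|exact: cvg_cst].
  exact: cvg_unique _ A B.
have H2 : G m - G a = F m - F a.
  have A : G m - G u @[u --> a^'+] --> G m - G a.
    by apply: cvgB; [exact: cvg_cst|exact: Ga].
  have B : G m - G u @[u --> a^'+] --> F m - F a.
    apply: (@cvg_trans _ (F m - F u @[u --> a^'+])).
      by apply: near_eq_cvg; near=> u; rewrite /= GF.
    by apply: cvgB; [exact: cvg_cst|exact: Fa].
  exact: cvg_unique _ A B.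
lra.
Unshelve. all: by end_near. Qed.

End FTC_integrable.

(** * Integration against the singular kernel [(X - u) ^ (- alpha)] *)

Section Kernel.
Variables (R : realType) (alpha : R).
Hypothesis alpha_lt1 : alpha < 1.
Notation mu := (@lebesgue_measure R).

Lemma measurable_kernel (D : set R) (X : R) :
  measurable_fun D (fun u : R => ((X - u) `^ alpha)^-1).
Proof.
under eq_fun do rewrite -powRN.
have m1 : measurable_fun [set: R] (@powR R ^~ (- alpha)) := @measurable_powR R _.
have m2 : measurable_fun D (fun u : R => X - u) by apply: measurable_funB.
exact: measurableT_comp m1 m2.
Qed.

Lemma is_derive_powR_subl (b X u : R) : u < X ->
  is_derive u (1 : R) (fun v : R => (X - v) `^ b) (- (b * (X - u) `^ (b - 1))).
Proof.
move=> uX.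
have Xu : 0 < X - u by rewrite subr_gt0.
have D : is_derive u (1 : R) (fun v : R => X - v) (-1).
  by apply: is_derive_eq; rewrite add0r mul1r.
by have := @is_derive1_comp _ (@powR R ^~ b) (fun v : R => X - v) u _ _
  (is_derive1_powR b Xu) D; rewrite mulrN1.
Qed.

Lemma cvg_powR_subl (b X : R) : 0 < b -> (X - u) `^ b @[u --> X^'-] --> 0.
Proof.
move=> b0.
have H : (X - u) @[u --> X^'-] --> (0:R)^'+.
  move=> P [e /= e0 He]; exists e => // u /= Xu uX.
  by apply: He; rewrite /= ?subr_gt0 // /ball_ /= sub0r normrN.
exact: (cvg_comp _ _ H (powR_cvg0 b0)).
Qed.

Lemma continuous_kernel (X u : R) : u < X ->
  {for u, continuous (fun v : R => ((X - v) `^ alpha)^-1)}.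
Proof.
move=> uX; rewrite (_ : (fun v => _) = (fun v : R => (X - v) `^ (- alpha))); last first.
  by apply/funext => v; rewrite powRN.
apply/differentiable_continuous/derivable1_diffP.
by have := is_derive_powR_subl (- alpha) uX => ?; exact: ex_derive.
Qed.

Lemma is_derive_primitive_kernel (X u : R) : u < X ->
  is_derive u (1 : R) (fun v : R => - ((X - v) `^ (1 - alpha)) / (1 - alpha))
   ((X - u) `^ alpha)^-1.
Proof.
move=> uX; have D := is_derive_powR_subl (1 - alpha) uX.
have n0 : 1 - alpha != 0 by rewrite gt_eqF// subr_gt0.
have E : 1 - alpha - 1 = - alpha by ring.
apply: is_derive_eq; rewrite /GRing.scale /= E -powRN; field.
by [].
Qed.

(** The explicit primitive bounds the integral over [[0, b]], [b < X], by a constant [C] independent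
    of [b]; monotone convergence along [b = X - 1 / (n + 1)] carries the bound to the whole
    interval. *)
Lemma integrable_kernel (X : R) :
  mu.-integrable `[0, X] (EFin \o (fun u : R => ((X - u) `^ alpha)^-1)).
Proof.
pose k := fun u : R => ((X - u) `^ alpha)^-1.
have k0 u : 0 <= k u by rewrite invr_ge0 powR_ge0.
have mk D : measurable_fun D (EFin \o k).
  by apply/measurable_EFinP; exact: measurable_kernel.
apply/integrableP; split; first exact: mk.
under eq_integral do rewrite /= ger0_norm ?k0//.
rewrite -integral_itv_bndo_bndc; last exact: mk.
rewrite itv_bnd_open_bigcup.
pose C := X `^ (1 - alpha) / (1 - alpha).
have a1 : 0 < 1 - alpha by rewrite subr_gt0.
have C0 : 0 <= C by rewrite divr_ge0 ?powR_ge0 ?ltW.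
have bnd b : b < X -> (\int[mu]_(u in `[0%R, b]) (k u)%:E <= C%:E)%E.
  (* The truncation points [X - 1 / (n + 1)] may be negative, so [b <= 0] has to be covered. *)
  move=> bX; have [b0|] := ltP 0 b; last first.
    rewrite le_eqVlt => /predU1P[->|b0].
      by rewrite set_itv1 integral_set1 lee_fin.
    by rewrite set_itv_ge ?integral_set0 ?lee_fin// bnd_simp -ltNge.
  pose F := fun v : R => - ((X - v) `^ (1 - alpha)) / (1 - alpha).
  have dF u : u <= b -> is_derive u (1 : R) F (k u).
    by move=> ub; apply: is_derive_primitive_kernel; exact: le_lt_trans bX.
  have cF : {within `[0, b], continuous F}.
    apply: derivable_within_continuous => u /[!in_itv]/= /andP[_ ub].
    by have := dF u ub => ?; exact: ex_derive.
  rewrite (@continuous_FTC2 _ k F)//.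
  - rewrite /F subr0 -EFinB lee_fin mulNr mulNr opprK addrC lerBlDr lerDl.
    by rewrite divr_ge0 ?powR_ge0 ?ltW.
  - apply: continuous_in_subspaceT => u; rewrite inE /= in_itv /= => /andP[_ ub].
    by apply: continuous_kernel; exact: le_lt_trans bX.
  - have [_ F0 Fb] := (continuous_within_itvP _ b0).1 cF.
    split=> // u /[!in_itv]/= /andP[_ ub].
    by have := dF u (ltW ub) => ?; exact: ex_derive.
  - move=> u /[!in_itv]/= /andP[_ ub].
    by have := dF u (ltW ub) => ?; rewrite derive1E derive_val.
have nd : nondecreasing_seq (fun n : nat => [set` `[0, X - n.+1%:R^-1]]).
  move=> m n mn; apply/subsetPset/subset_itvl.
  by rewrite bnd_simp lerD2l lerN2 lef_pV2 ?posrE// ler_nat.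
have H : (\int[mu]_(x in [set` `[0%R, (X - n.+1%:R^-1)%R]]) (k x)%:E)%E @[n --> \oo] -->
    (\int[mu]_(x in \bigcup_n [set` `[0%R, (X - n.+1%:R^-1)%R]]) (k x)%:E)%E.
  apply: ge0_nondecreasing_set_cvg_integral => //.
    by move=> i; exact: mk.
  by move=> i x Fx; rewrite lee_fin.
apply: (le_lt_trans _ (ltry C)).
rewrite -(cvg_lim _ H)//.
apply: lime_le; first by apply: cvgP H.
by apply: nearW => n; apply: bnd; rewrite ltrBlDr ltrDl invr_gt0.
Unshelve. all: by end_near. Qed.

Lemma integrable_mul_kernel (g : R -> R) (X : R) : continuous g ->
  mu.-integrable `[0, X] (EFin \o (fun u : R => g u / (X - u) `^ alpha)).
Proof.
move=> cg.
have := @integrableMr _ _ _ mu `[0, X]%classic _ g (EFin \o (fun u : R => ((X - u) `^ alpha)^-1)).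
apply => //.
- exact: measurable_funTS (continuous_measurable_fun cg).
- have [M [Mr HM]] := compact_bounded
    (continuous_compact (continuous_subspaceT cg) (@segment_compact _ 0 X)).
  by exists M; split => // y yM z zX; apply: HM => //; exists z.
- exact: integrable_kernel.
Qed.

Lemma cvg_at_right_scale (X : R) : 0 < X -> u / X @[u --> (0 : R)^'+] --> (0 : R)^'+.
Proof.
move=> X0 P [e /= e0 He]; exists (e * X) => [|u /= + u0]; first exact: mulr_gt0.
rewrite /ball_ /= !sub0r !normrN => uX.
apply: He; rewrite /= ?divr_gt0// sub0r normrN normrM normfV (gtr0_norm X0).
by rewrite ltr_pdivrMr.
Qed.

Lemma cvg_at_left_scale (X : R) : 0 < X -> u / X @[u --> X^'-] --> (1 : R)^'-.
Proof.
move=> X0 P [e /= e0 He]; exists (e * X) => [|u /= + uX]; first exact: mulr_gt0.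
rewrite /ball_ /= => H.
apply: He; last by rewrite /= ltr_pdivrMr ?mul1r.
have Xn0 : X != 0 by rewrite gt_eqF.
rewrite /ball_ /= -(divff Xn0) -mulrBl normrM normfV (gtr0_norm X0).
by rewrite ltr_pdivrMr.
Qed.

(** This is the substitution [u = X * s]. With [G] the indefinite integral of the scaled integrand,
    [X ^ (1 - alpha) * G (u / X)] is a primitive of the left integrand inside the interval and is
    continuous up to both endpoints. *)
Lemma integral_kernel_scale (p : R -> R) (X : R) : continuous p -> 0 < X ->
  \int[mu]_(u in `[0, X]) (p u / (X - u) `^ alpha) =
  X `^ (1 - alpha) * \int[mu]_(s in `[0, 1]) (p (X * s) / (1 - s) `^ alpha).
Proof.
move=> cp X0.
pose q s := p (X * s) / (1 - s) `^ alpha.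
have cpX : continuous (fun s => p (X * s)).
  move=> s; apply: (@continuous_comp _ _ _ (fun s => X * s) p); last exact: cp.
  exact: mulrl_continuous.
have intq : mu.-integrable `[0, 1] (EFin \o q) by exact: integrable_mul_kernel.
pose G t := \int[mu]_(s in `[0, t]) q s.
have [_ G0 G1] := (continuous_within_itvP _ ltr01).1
  (parameterized_integral_continuous ler01 intq).
pose F u := X `^ (1 - alpha) * G (u / X).
transitivity (F X - F 0); last first.
  rewrite /F divff ?gt_eqF// mul0r [G 0]/G set_itv1 Rintegral_set1.
  by rewrite mulr0 subr0.
apply: FTC2_integrable => //.
- exact: integrable_mul_kernel.
- move=> u /[!in_itv]/= /andP[_ uX].
  by apply: cvgM; [exact: cp|exact: continuous_kernel].
- rewrite /F; apply: cvgM; first exact: cvg_cst.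
  rewrite mul0r; apply: (cvg_comp _ _ (cvg_at_right_scale X0)); exact: G0.
- rewrite /F; apply: cvgM; first exact: cvg_cst.
  rewrite divff ?gt_eqF//; apply: (cvg_comp _ _ (cvg_at_left_scale X0)); exact: G1.
move=> u /andP[u0 uX].
have uX1 : u / X < 1 by rewrite ltr_pdivrMr ?mul1r.
have cq : {for (u / X), continuous q}.
  by apply: cvgM; [exact: cpX|exact: continuous_kernel].
have [dG G'] := continuous_FTC1_closed uX1 intq (divr_gt0 u0 X0) cq.
have DG : is_derive (u / X) (1 : R) G (q (u / X)).
  by apply: DeriveDef => //; rewrite -derive1E.
have D1 : is_derive u (1 : R) (fun v : R => v / X) X^-1.
  by apply: is_derive_eq; rewrite /GRing.scale /= ?mulr1 ?mulr0 ?add0r.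
have D2 := @is_derive1_comp _ G (fun v : R => v / X) u _ _ DG D1.
have D3 : is_derive u (1 : R) (fun v => X `^ (1 - alpha) * (G \o (fun v : R => v / X)) v)
   (X `^ (1 - alpha) * (q (u / X) * X^-1)).
  by apply: is_derive_eq; rewrite /GRing.scale /= ?mulr0 ?addr0.
move: D3; congr (is_derive _ _ _ _).
(* Homogeneity: [X - u] contributes [X ^ alpha] times [(1 - u / X) ^ alpha], and
   [X ^ (1 - alpha) / X] cancels the first factor. *)
have Xn0 : X != 0 by rewrite gt_eqF.
have -> : X - u = X * (1 - u / X) by field.
rewrite powRM ?(ltW X0)//; last by rewrite subr_ge0 ltW.
have XuX : X * (u / X) = u by field.
rewrite /q XuX.
rewrite powRB ?Xn0 ?implybT// powRr1 ?ltW//.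
field.
rewrite !gt_eqF ?powR_gt0//; last by rewrite subr_gt0.
Qed.

(** The integrand is the derivative of [(1 - s) ^ (1 - alpha) * h s], which vanishes at [s = 1]
    because [alpha < 1] and equals [h 0] at [s = 0]. *)
Lemma integral_kernel_by_parts (h h' : R -> R) :
  (forall s : R, is_derive s (1 : R) h (h' s)) -> continuous h' ->
  \int[mu]_(s in `[0, 1]) (((1 - s) * h' s - (1 - alpha) * h s) / (1 - s) `^ alpha)
  = - h 0.
Proof.
move=> dh ch'.
have ch : continuous h.
  move=> s; apply/differentiable_continuous/derivable1_diffP.
  by have := dh s => ?; exact: ex_derive.
have a1 : 1 - alpha != 0 by rewrite gt_eqF// subr_gt0.
have cn : continuous (fun s : R => (1 - s) * h' s - (1 - alpha) * h s).
  move=> s; apply: cvgB; last by apply: cvgM; [exact: cvg_cst|exact: ch].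
  by apply: cvgM; [apply: cvgB; [exact: cvg_cst|exact: cvg_id]|exact: ch'].
pose F (s : R) := (1 - s) `^ (1 - alpha) * h s.
have dF (s : R) : s < 1 -> is_derive s (1 : R) F
    (((1 - s) * h' s - (1 - alpha) * h s) / (1 - s) `^ alpha).
  move=> s1; have D := is_derive_powR_subl (1 - alpha) s1.
  have E : 1 - alpha - 1 = - alpha by ring.
  have s0 : 0 < 1 - s by rewrite subr_gt0.
  apply: is_derive_eq; rewrite /GRing.scale /= E powRN.
  rewrite powRB; last by rewrite gt_eqF// implybT.
  by rewrite powRr1 ?ltW//; field; rewrite gt_eqF ?powR_gt0.
transitivity (F 1 - F 0).
  apply: FTC2_integrable => //.
  - exact: integrable_mul_kernel.
  - move=> u /[!in_itv]/= /andP[_ u1].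
    by apply: cvgM; [exact: cn|exact: continuous_kernel].
  - apply: cvg_at_right_filter; apply/differentiable_continuous/derivable1_diffP.
    by have := dF 0 ltr01 => ?; exact: ex_derive.
  (* At 1 only continuity is available: the power tends to 0 there, but need not be
     differentiable. *)
  - rewrite [F 1]/F subrr powR0//; apply: cvgM; last exact/cvg_at_left_filter/ch.
    by apply: cvg_powR_subl; rewrite subr_gt0.
  - by move=> s /andP[_ s1]; exact: dF.
by rewrite /F subrr powR0// mul0r subr0 powR1 mul1r sub0r.
Qed.

Lemma continuousZl (c : R) (g : R -> R) : continuous g -> continuous (fun s => c * g s).
Proof. by move=> cg s; apply: cvgM; [exact: cvg_cst|exact: cg]. Qed.

Lemma continuous_fun_add (g1 g2 : R -> R) : continuous g1 -> continuous g2 ->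
  continuous (fun s => g1 s + g2 s).
Proof. by move=> c1 c2 s; apply: cvgD; [exact: c1|exact: c2]. Qed.

Definition kernel_integral (g : R -> R) :=
  \int[mu]_(s in `[0, 1]) (g s / (1 - s) `^ alpha).

Lemma kernel_integralD (g1 g2 : R -> R) : continuous g1 -> continuous g2 ->
  kernel_integral (fun s => g1 s + g2 s) = kernel_integral g1 + kernel_integral g2.
Proof.
move=> c1 c2; rewrite /kernel_integral.
under eq_Rintegral do rewrite mulrDl.
by rewrite RintegralD//; exact: integrable_mul_kernel.
Qed.

Lemma kernel_integralZ (c : R) (g : R -> R) : continuous g ->
  kernel_integral (fun s => c * g s) = c * kernel_integral g.
Proof.
move=> cg; rewrite /kernel_integral.
under eq_Rintegral do rewrite -mulrA.
by rewrite RintegralZl//; exact: integrable_mul_kernel.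
Qed.

(** The kernel is nonnegative. This turns a Taylor remainder bounded uniformly in [s] into a
    remainder for the integral. *)
Lemma kernel_integral_le (g : R -> R) (C : R) : continuous g ->
  (forall s, 0 <= s <= 1 -> `|g s| <= C) ->
  `|kernel_integral g| <= C * kernel_integral (fun=> 1).
Proof.
move=> cg gC; rewrite -kernel_integralZ; last exact: cst_continuous.
have ig := integrable_mul_kernel 1 cg.
rewrite (le_trans (le_normr_Rintegral _ ig))//.
apply: le_Rintegral => //.
- exact: (integrable_norm ig).
- by apply: integrable_mul_kernel => //; exact: cst_continuous.
move=> s /=; rewrite in_itv /= => s01.
rewrite normrM (ger0_norm (_ : 0 <= ((1 - s) `^ alpha)^-1)) ?invr_ge0 ?powR_ge0//.
by rewrite mulr1 ler_wpM2r ?invr_ge0 ?powR_ge0// gC.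
Qed.

End Kernel.

(** * First-order expansions with quadratic remainder *)

Section Taylor1.
Variable R : realType.
Implicit Types (f g : R -> R).

Lemma continuous_bounded_itv f (a b : R) : {within `[a, b], continuous f} ->
  exists2 C, 0 <= C & forall x, a <= x <= b -> `|f x| <= C.
Proof.
move=> cf.
have [M [Mr HM]] := compact_bounded (continuous_compact cf (@segment_compact _ a b)).
exists (`|M| + 1) => [|x xab]; first by rewrite addr_ge0.
apply: HM; first by rewrite (le_lt_trans (ler_norm M))// ltrDl.
by exists x => //=; rewrite in_itv.
Qed.

Lemma mvt_bound f f' (m M C : R) :
  (forall x : R, m <= x <= M -> is_derive x (1 : R) f (f' x)) ->
  (forall x, m <= x <= M -> `|f' x| <= C) ->
  forall a b, m <= a <= M -> m <= b <= M -> `|f b - f a| <= C * `|b - a|.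
Proof.
move=> df f'C a b; wlog ab : a b / a <= b.
  by move=> H aI bI; have [|/ltW] := leP a b => ab; [|rewrite distrC (distrC b)]; exact: H.
move=> /andP[ma aM] /andP[mb bM].
have df' x : a <= x <= b -> is_derive x (1 : R) f (f' x).
  by move=> /andP[ax xb]; apply: df; rewrite (le_trans ma ax) (le_trans xb bM).
have [||c] := @MVT_segment _ f f' a b ab.
- by move=> x /[!in_itv]/= /andP[ax xb]; apply: df'; rewrite !ltW.
- apply: derivable_within_continuous => x /[!in_itv]/= xab.
  by have := df' x xab => ?; exact: ex_derive.
rewrite in_itv/= => /andP[ac cb] ->; rewrite normrM ler_wpM2r//.
by apply: f'C; rewrite (le_trans ma ac) (le_trans cb bM).
Qed.

(** The mean value inequality is used twice: for [f'], then for [x |-> f x - x * f' a], whose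
    derivative [f' x - f' a] is at most [C * |b - a|] between [a] and [b]. This gives [C] rather
    than [C / 2], which is enough here. *)
Lemma taylor_bound f f' f'' (m M C : R) :
  (forall x : R, m <= x <= M -> is_derive x (1 : R) f (f' x)) ->
  (forall x : R, m <= x <= M -> is_derive x (1 : R) f' (f'' x)) ->
  (forall x, m <= x <= M -> `|f'' x| <= C) ->
  forall a b, m <= a <= M -> m <= b <= M ->
    `|f b - f a - (b - a) * f' a| <= C * (b - a) ^+ 2.
Proof.
move=> df df' f''C a b aI bI.
have C0 : 0 <= C := le_trans (normr_ge0 _) (f''C a aI).
pose g x := f x - x * f' a.
(* The second inequality is applied on the interval spanned by [a] and [b], where
   [|x - a| <= |b - a|]. *)
pose lo := Num.min a b; pose hi := Num.max a b.
have I x : lo <= x <= hi -> m <= x <= M.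
  move=> /andP[]; rewrite ge_min le_max => lx xh; move: aI bI => /andP[? ?] /andP[? ?].
  apply/andP; split; first by case/orP: lx => H; exact: le_trans H.
  by case/orP: xh => H; exact: le_trans H _.
have dg x : lo <= x <= hi -> is_derive x (1 : R) g (f' x - f' a).
  move=> /I xI; have ? := df x xI.
  by apply: is_derive_eq; rewrite /GRing.scale /= ?mulr0 ?mulr1 ?add0r ?addr0.
have gC x : lo <= x <= hi -> `|f' x - f' a| <= C * `|b - a|.
  move=> xI; apply: le_trans (mvt_bound df' f''C aI (I x xI)) _.
  apply: ler_wpM2l => //.
  move: xI; rewrite /lo /hi; case: (leP a b) => ab /andP[H1 H2].
    by rewrite !ger0_norm ?subr_ge0// lerD2r.
  by rewrite !ler0_norm ?subr_le0 ?(ltW ab)// !opprB lerD2l lerN2.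
have aI' : lo <= a <= hi by rewrite ge_min le_max lexx.
have bI' : lo <= b <= hi by rewrite ge_min le_max lexx !orbT.
have := mvt_bound dg gC aI' bI'.
rewrite -mulrA -expr2 -normrX (ger0_norm (sqr_ge0 _)).
by congr (`|_| <= _); rewrite /g; ring.
Qed.

(** Differentiability at [a] with derivative [D] and an explicit quadratic remainder, as the final
    [O(phi^2)] demands. The sign of [C] is left free, whence the absolute values of constants in the
    bounds below. *)
Definition taylor1 f (a D : R) :=
  exists C, \forall h \near (0 : R), `|f (a + h) - f a - h * D| <= C * h ^+ 2.

(** By compactness the continuous [f''] is bounded on [[a - d, a + d]], which provides the
    constant. *)
Lemma taylor1_derive2 f f' f'' (a d : R) : 0 < d ->
  (forall x : R, `|x - a| <= d -> is_derive x (1 : R) f (f' x)) ->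
  (forall x : R, `|x - a| <= d -> is_derive x (1 : R) f' (f'' x)) ->
  (forall x : R, `|x - a| <= d -> {for x, continuous f''}) ->
  taylor1 f a (f' a).
Proof.
move=> d0; set P := fun x => `|x - a| <= d.
have PE x : (a - d <= x <= a + d) = (`|x - a| <= d).
  by rewrite ler_distl.
move=> df df' cf.
have [|C C0 HC] := @continuous_bounded_itv f'' (a - d) (a + d).
  by apply: continuous_in_subspaceT => x /[!inE]/= /[!in_itv]/=; rewrite PE; exact: cf.
exists C; near=> h.
have H := @taylor_bound f f' f'' (a - d) (a + d) C.
have E : a + h - a = h by ring.
have := H _ _ HC a (a + h); rewrite E; apply.
- by move=> x; rewrite PE; exact: df.
- by move=> x; rewrite PE; exact: df'.
- by rewrite PE subrr normr0 ltW.
- rewrite PE E; near: h.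
  by apply/nbhs_ballP; exists d => //= z; rewrite /ball /= sub0r normrN => /ltW.
Unshelve. all: by end_near. Qed.

(** The remainder of the product is [g a] times that of [f], plus [f a] times that of [g], plus the
    product of the two increments, each of which is [O(h)]. *)
Lemma taylor1M f g (a D E : R) : taylor1 f a D -> taylor1 g a E ->
  taylor1 (fun x => f x * g x) a (D * g a + f a * E).
Proof.
move=> [C HC] [C' HC'].
exists (`|g a| * C + `|f a| * C' + (`|D| + `|C|) * (`|E| + `|C'|)); near=> h.
have h1 : `|h| <= 1.
  by near: h; apply/nbhs_ballP; exists 1 => //= z; rewrite /ball /= sub0r normrN => /ltW.
have H1 : `|f (a + h) - f a - h * D| <= C * h ^+ 2 by near: h.
have H2 : `|g (a + h) - g a - h * E| <= C' * h ^+ 2 by near: h.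
(* Since [|h| <= 1], a remainder of order [h ^+ 2] is also of order [|h|]. *)
have step (u D' K : R) : `|u - h * D'| <= K * h ^+ 2 -> `|u| <= `|h| * (`|D'| + `|K|).
  move=> H; rewrite -(subrK (h * D') u) (le_trans (ler_normD _ _))// addrC.
  rewrite mulrDr normrM lerD2l (le_trans H)// -real_normK ?num_real// mulrC expr2 -mulrA.
  rewrite ler_wpM2l// (le_trans (ler_norm _))// normrM normr_id.
  by rewrite ler_piMl.
have H3 := step _ _ _ H1; have H4 := step _ _ _ H2.
have -> : f (a + h) * g (a + h) - f a * g a - h * (D * g a + f a * E) =
  g a * (f (a + h) - f a - h * D) + f a * (g (a + h) - g a - h * E) +
  (f (a + h) - f a) * (g (a + h) - g a) by ring.
rewrite (le_trans (ler_normD _ _))// [leRHS]mulrDl lerD//.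
  rewrite (le_trans (ler_normD _ _))// [leRHS]mulrDl lerD// normrM -mulrA ler_wpM2l//.
rewrite normrM.
have -> : h ^+ 2 = `|h| * `|h| by rewrite -expr2 real_normK ?num_real.
have -> : (`|D| + `|C|) * (`|E| + `|C'|) * (`|h| * `|h|) =
   (`|h| * (`|D| + `|C|)) * (`|h| * (`|E| + `|C'|)) by ring.
by rewrite ler_pM.
Unshelve. all: by end_near. Qed.

Lemma taylor1_lipschitz f a D : taylor1 f a D ->
  exists2 L, 0 < L & \forall h \near (0 : R), `|f (a + h) - f a| <= L * `|h|.
Proof.
move=> [C HC]; exists (`|D| + `|C| + 1); first by rewrite ltr_pwDr ?addr_ge0.
near=> h.
have h1 : `|h| <= 1.
  by near: h; apply/nbhs_ballP; exists 1 => //= z; rewrite /ball /= sub0r normrN => /ltW.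
have H : `|f (a + h) - f a - h * D| <= C * h ^+ 2 by near: h.
rewrite -(subrK (h * D) (f (a + h) - f a)) (le_trans (ler_normD _ _))//.
have -> : (`|D| + `|C| + 1) * `|h| = `|C| * `|h| + `|h| + `|h| * `|D| by ring.
rewrite normrM lerD// (le_trans H)//.
rewrite ler_wpDr// -real_normK ?num_real// expr2 mulrA.
by rewrite ler_wpM2r// (le_trans (ler_norm _))// normrM normr_id ler_piMr.
Unshelve. all: by end_near. Qed.

(** With [k] the increment of [g], the remainder is that of [f] at [k], controlled by
    [k ^+ 2 <= L ^+ 2 * h ^+ 2], plus [D] times the remainder of [g]. *)
Lemma taylor1_comp f g (a D E : R) : taylor1 f (g a) D -> taylor1 g a E ->
  taylor1 (fun x => f (g x)) a (D * E).
Proof.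
move=> [C [d /= d0 Hd]] Tg; have [L L0 HL] := taylor1_lipschitz Tg; case: Tg => [C' HC'].
exists (`|C| * L ^+ 2 + `|D| * C'); near=> h.
have H1 : `|g (a + h) - g a| <= L * `|h| by near: h.
have H2 : `|g (a + h) - g a - h * E| <= C' * h ^+ 2 by near: h.
set k := g (a + h) - g a in H1 H2 *.
have H3 : `|f (g a + k) - f (g a) - k * D| <= C * k ^+ 2.
  apply: Hd; rewrite /= /ball_ /= sub0r normrN (le_lt_trans H1)//.
  (* Taking [|h| < d / L] keeps [k] within the radius [d] where the expansion of [f] is valid; this
     is why [L] is strictly positive. *)
  rewrite mulrC -ltr_pdivlMr//; near: h.
  by exists (d / L) => /=; [rewrite divr_gt0|move=> z; rewrite /ball_ /= sub0r normrN].
have -> : g (a + h) = g a + k by rewrite /k subrKC.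
have -> : f (g a + k) - f (g a) - h * (D * E) =
  (f (g a + k) - f (g a) - k * D) + D * (k - h * E) by ring.
rewrite (le_trans (ler_normD _ _))// [leRHS]mulrDl lerD//; last first.
  by rewrite normrM -mulrA ler_wpM2l.
rewrite (le_trans H3)// -(real_normK (num_real k)) -(real_normK (num_real h)).
rewrite -mulrA -exprMn.
apply: (@le_trans _ _ (`|C| * `|k| ^+ 2)); first by rewrite ler_wpM2r ?exprn_ge0 ?ler_norm.
by rewrite ler_wpM2l// lerXn2r ?nnegrE// mulr_ge0// ltW.
Unshelve. all: by end_near. Qed.

Lemma taylor1Z (c : R) (g : R -> R) (a D : R) :
  taylor1 g a D -> taylor1 (fun z => c * g z) a (c * D).
Proof.
move=> [C HC]; exists (`|c| * C); near=> h.
have H : `|g (a + h) - g a - h * D| <= C * h ^+ 2 by near: h.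
have -> : c * g (a + h) - c * g a - h * (c * D) = c * (g (a + h) - g a - h * D) by ring.
by rewrite normrM -mulrA ler_wpM2l.
Unshelve. all: by end_near. Qed.

Lemma near_eq_taylor1 (g h : R -> R) (a D : R) :
  (\forall z \near (0 : R), g (a + z) = h (a + z)) -> taylor1 h a D -> taylor1 g a D.
Proof.
move=> gh [C HC]; exists C; near=> z.
have -> : g (a + z) = h (a + z) by near: z.
have -> : g a = h a by have := nbhs_singleton gh; rewrite addr0.
by near: z.
Unshelve. all: by end_near. Qed.

Lemma taylor1_bigO (g l : R -> R) (D : R) :
  taylor1 g 0 D -> l = (fun phi => g 0 + phi * D) ->
  g = l +O_ (0 : R) (fun phi => phi ^+ 2).
Proof.
move=> [C HC] ->; apply/eqaddOP/bigO_exP; exists (`|C| + 1); first by rewrite ltr_pwDr.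
near=> phi.
have : `|g (0 + phi) - g 0 - phi * D| <= C * phi ^+ 2 by near: phi.
rewrite add0r /= [`|phi ^+ 2|]ger0_norm ?sqr_ge0// -!fctE opprD addrA => /le_trans; apply.
by rewrite ler_wpM2r ?sqr_ge0// (le_trans (ler_norm C))// lerDl.
Unshelve. all: by end_near. Qed.

Lemma taylor1_powR (b x : R) : 0 < x -> taylor1 (fun z : R => z `^ b) x (b * x `^ (b - 1)).
Proof.
move=> x0.
(* The radius [x / 2] keeps the arguments of the power positive. *)
have d0 : 0 < x / 2 by rewrite divr_gt0.
have pos z : `|z - x| <= x / 2 -> 0 < z.
  by rewrite ler_distl => /andP[H _]; apply: lt_le_trans H; lra.
have D (c z : R) : 0 < z -> is_derive z (1 : R)
    (fun z : R => c * z `^ (b - 1)) (c * ((b - 1) * z `^ (b - 1 - 1))).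
  move=> z0; have ? := is_derive1_powR (b - 1) z0.
  by apply: is_derive_eq; rewrite /GRing.scale /=; ring.
apply: (@taylor1_derive2 _ (fun z => b * z `^ (b - 1))
  (fun z => b * ((b - 1) * z `^ (b - 1 - 1))) x (x / 2)) => // z /pos z0.
- exact: is_derive1_powR.
- exact: D.
- have ? := is_derive1_powR (b - 1 - 1) z0.
  by apply/differentiable_continuous/derivable1_diffP; exact: ex_derive.
Qed.

Lemma taylor1_rot_x (x y : R) : taylor1 (fun phi => rot_x phi x y) 0 y.
Proof.
pose f' (phi : R) := - sin phi * x + cos phi * y.
pose f'' (phi : R) := - cos phi * x - sin phi * y.
have -> : y = f' 0 by rewrite /f' sin0 cos0 oppr0 mul0r add0r mul1r.
apply: (@taylor1_derive2 _ f' f'' 0 1) => // phi _.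
- by apply: is_derive_eq; rewrite /f' sin0 cos0 /GRing.scale /=; ring.
- by apply: is_derive_eq; rewrite /f'' /GRing.scale /=; ring.
- by apply/differentiable_continuous/derivable1_diffP; exact: ex_derive.
Qed.

End Taylor1.

(** * The Caputo derivative of a radial function along a rotation *)

Section Caputo.
Variables (R : realType) (alpha : R).
Hypothesis alpha_lt1 : alpha < 1.
Variables (Psi : R -> R -> R) (F f f1 f2 : R -> R).
Hypothesis prof : radial_profile Psi F f f1 f2.
Notation I := (kernel_integral alpha).

Lemma sumsq_gt0 (u v : R) : 0 < v -> 0 < u ^+ 2 + v ^+ 2.
Proof. by move=> v0; rewrite ltr_wpDl ?sqr_ge0// exprn_gt0. Qed.

Lemma partial_x_radial (u v : R) : 0 < v ->
  partial_x Psi u v = 2 * u * f (u ^+ 2 + v ^+ 2).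
Proof.
move=> v0; rewrite /partial_x.
have -> : Psi^~ v = fun w : R => F (w ^+ 2 + v ^+ 2).
  by apply/funext => w; rewrite (radialE prof) ?sumsq_gt0.
have dF := derive_profile prof (sumsq_gt0 u v0).
have D : is_derive u (1 : R) (fun w : R => w ^+ 2 + v ^+ 2) (2 * u).
  by apply: is_derive_eq; rewrite /GRing.scale /=; ring.
have D2 := @is_derive1_comp _ F (fun w : R => w ^+ 2 + v ^+ 2) u _ _ dF D.
by rewrite derive1E derive_val mulrC.
Qed.

Lemma partial_y_radial (u v : R) : 0 < v ->
  partial_y Psi u v = 2 * v * f (u ^+ 2 + v ^+ 2).
Proof.
move=> v0; rewrite /partial_y derive1E.
(* The radial formula excludes the origin, which [(u, w)] meets at [w = 0] when [u = 0]; hence an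
   equality only for [w] near [v > 0]. *)
rewrite (@near_eq_derive _ _ _ _ (fun w : R => F (u ^+ 2 + w ^+ 2))); last first.
  by near=> w; rewrite (radialE prof)// sumsq_gt0//; near: w; exact: lt_nbhsr.
have dF := derive_profile prof (sumsq_gt0 u v0).
have D : is_derive v (1 : R) (fun w : R => u ^+ 2 + w ^+ 2) (2 * v).
  by apply: is_derive_eq; rewrite /GRing.scale /=; ring.
have D2 := @is_derive1_comp _ F (fun w : R => u ^+ 2 + w ^+ 2) v _ _ dF D.
by rewrite derive_val mulrC.
Unshelve. all: by end_near. Qed.

Lemma continuous_radial (g g' : R -> R) (q : R -> R) :
  (forall s : R, 0 < s -> is_derive s (1 : R) g (g' s)) ->
  continuous q -> (forall s, 0 < q s) -> continuous (fun s => g (q s)).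
Proof.
move=> dg cq q0 s; apply: (@continuous_comp _ _ _ q g); first exact: cq.
apply/differentiable_continuous/derivable1_diffP.
by have := dg _ (q0 s) => ?; exact: ex_derive.
Qed.

(* On the circle of radius sqrt rho, rho - w * (1 - s^2) with w = X^2 is the squared
   norm of the point (X s, Y). *)
Definition circle_integral (rho w : R) :=
  I (fun s => 2 * s * f (rho - w * (1 - s ^+ 2))).

(** The argument of [g] equals [(rho - w) + w * s ^+ 2], which is positive. *)
Lemma continuous_circle (g g' : R -> R) (rho w : R) :
  (forall s : R, 0 < s -> is_derive s (1 : R) g (g' s)) -> 0 <= w < rho ->
  continuous (fun s : R => g (rho - w * (1 - s ^+ 2))).
Proof.
move=> dg /andP[w0 wr]; apply: (continuous_radial dg) => s.
  apply/differentiable_continuous/derivable1_diffP; exact: ex_derive.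
rewrite (_ : _ - _ = (rho - w) + w * s ^+ 2); last by ring.
by rewrite ltr_wpDr ?subr_gt0// mulr_ge0// sqr_ge0.
Qed.

(** Scaling produces [X ^ (1 - alpha)], and the factor [u = X * s] of the partial derivative one
    more [X]. Once the squared radius is fixed, only [X] varies. *)
Lemma caputo_xE (X Y : R) : 0 < X -> 0 < Y ->
  caputo_x alpha Psi X Y =
  (Gamma (1 - alpha))^-1 * (X `^ (2 - alpha) * circle_integral (X ^+ 2 + Y ^+ 2) (X ^+ 2)).
Proof.
move=> X0 Y0; rewrite /caputo_x; congr (_ * _).
under eq_Rintegral do rewrite partial_x_radial//.
have cf : continuous (fun u : R => 2 * u * f (u ^+ 2 + Y ^+ 2)).
  move=> u; apply: cvgM; first exact: mulrl_continuous.
  apply: (@continuous_radial f f1 (fun u : R => u ^+ 2 + Y ^+ 2)) => [|s|s].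
  - exact: derive_profile1 prof.
  - apply/differentiable_continuous/derivable1_diffP; exact: ex_derive.
  - exact: sumsq_gt0.
rewrite (@integral_kernel_scale _ _ alpha_lt1 (fun u : R => 2 * u * f (u ^+ 2 + Y ^+ 2)))//.
have -> : 2 - alpha = (1 - alpha) + 1 by ring.
rewrite [in RHS]powRD; last by rewrite (gt_eqF X0) implybT.
rewrite powRr1 ?ltW// -mulrA; congr (_ * _).
rewrite -[RHS]kernel_integralZ//.
  apply: eq_Rintegral => s _; congr (_ / _).
  have -> : (X * s) ^+ 2 + Y ^+ 2 = X ^+ 2 + Y ^+ 2 - X ^+ 2 * (1 - s ^+ 2) by ring.
  by ring.
move=> s; apply: cvgM; first exact: mulrl_continuous.
apply: (continuous_circle (derive_profile1 prof)).
by rewrite sqr_ge0 ltrDl exprn_gt0.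
Qed.

Lemma RL_integral_x_partial_yE (X Y : R) : 0 < X -> 0 < Y ->
  RL_integral_x alpha (partial_y Psi) X Y =
  (Gamma (1 - alpha))^-1 *
  (X `^ (1 - alpha) * (2 * Y * I (fun s => f (X ^+ 2 + Y ^+ 2 - X ^+ 2 * (1 - s ^+ 2))))).
Proof.
move=> X0 Y0; rewrite /RL_integral_x; congr (_ * _).
under eq_Rintegral do rewrite partial_y_radial//.
have cf : continuous (fun u : R => 2 * Y * f (u ^+ 2 + Y ^+ 2)).
  move=> u; apply: cvgM; first exact: cvg_cst.
  apply: (@continuous_radial f f1 (fun u : R => u ^+ 2 + Y ^+ 2)) => [|s|s].
  - exact: derive_profile1 prof.
  - apply/differentiable_continuous/derivable1_diffP; exact: ex_derive.
  - exact: sumsq_gt0.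
rewrite (@integral_kernel_scale _ _ alpha_lt1 (fun u : R => 2 * Y * f (u ^+ 2 + Y ^+ 2)))//.
congr (_ * _); rewrite -[RHS]kernel_integralZ//.
  apply: eq_Rintegral => s _; congr (_ / _).
  by have -> : (X * s) ^+ 2 + Y ^+ 2 = X ^+ 2 + Y ^+ 2 - X ^+ 2 * (1 - s ^+ 2) by ring.
apply: (continuous_circle (derive_profile1 prof)).
by rewrite sqr_ge0 ltrDl exprn_gt0.
Qed.

Lemma continuous_weight : continuous (fun s : R => 2 * s * (1 - s ^+ 2)).
Proof.
move=> s; apply/differentiable_continuous/derivable1_diffP; exact: ex_derive.
Qed.

(** Differentiation under the integral sign, by expanding [f] at [rho - w * (1 - s ^+ 2)] with a
    constant independent of [s]. *)
Lemma taylor1_circle_integral (rho w : R) : 0 < w < rho ->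
  taylor1 (circle_integral rho) w
    (I (fun s => - (2 * s * (1 - s ^+ 2) * f1 (rho - w * (1 - s ^+ 2))))).
Proof.
move=> /andP[w0 wr].
(* As [rho - (w + m) = m], the arguments of [f] stay in [[m, rho]], away from 0, for every increment
   of [w] between [- w] and [m]. *)
pose m := (rho - w) / 2.
have m0 : 0 < m by rewrite divr_gt0// subr_gt0.
have [|C C0 HC] := @continuous_bounded_itv _ f2 m rho.
  apply: continuous_in_subspaceT => s /[!inE]/= /[!in_itv]/= /andP[ms _].
  exact: continuous_profile2 prof _ (lt_le_trans m0 ms).
have df s : m <= s <= rho -> is_derive s (1 : R) f (f1 s).
  by move=> /andP[ms _]; exact: derive_profile1 prof _ (lt_le_trans m0 ms).
have df1 s : m <= s <= rho -> is_derive s (1 : R) f1 (f2 s).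
  by move=> /andP[ms _]; exact: derive_profile2 prof _ (lt_le_trans m0 ms).
have cid2 : continuous (fun s : R => 2 * s) by exact: mulrl_continuous.
have c1 v : 0 <= v < rho -> continuous (fun s : R => 2 * s * f (rho - v * (1 - s ^+ 2))).
  move=> vI s; apply: cvgM; [exact: cid2|exact: (continuous_circle (derive_profile1 prof))].
have c2 : continuous (fun s : R => - (2 * s * (1 - s ^+ 2) * f1 (rho - w * (1 - s ^+ 2)))).
  move=> s; apply: cvgN; apply: cvgM; first exact: continuous_weight.
  by apply: (continuous_circle (derive_profile2 prof)); rewrite ltW.
have wI : 0 <= w < rho by rewrite ltW.
(* By linearity the whole remainder becomes one kernel integral, so that it can be bounded pointwise
   in [s]. *)
have E (h : R) (g1 g2 g3 : R -> R) : continuous g1 -> continuous g2 -> continuous g3 ->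
    I g1 - I g2 - h * I g3 = I (fun s => (g1 s + (-1) * g2 s) + (- h) * g3 s).
  move=> cg1 cg2 cg3.
  rewrite kernel_integralD//; last 2 first.
  - exact: (continuous_fun_add cg1 (continuousZl cg2)).
  - exact: continuousZl.
  rewrite kernel_integralD//; last exact: continuousZl.
  by rewrite !kernel_integralZ// mulN1r mulNr.
(* The 2 bounds the weight [2 * s], and [C] bounds [f2] on [[m, rho]]; the factor
   [(1 - s ^+ 2) ^+ 2] is at most 1. *)
exists (2 * C * I (fun=> 1)); near=> h.
have hd : `|h| < Num.min w m.
  near: h; exists (Num.min w m) => /=; first by rewrite lt_min w0.
  by move=> z; rewrite /ball_ /= sub0r normrN.
move: hd; rewrite lt_min => /andP[hw hm].
have [h1 h2] : - w < h /\ h < m.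
  by move: hw hm; rewrite !ltr_norml => /andP[? _] /andP[_ ?].
have whI : 0 <= w + h < rho.
  by move: h2; rewrite /m => h2; apply/andP; split; lra.
rewrite /circle_integral E//; try exact: c1.
have -> : 2 * C * I (fun=> 1) * h ^+ 2 = 2 * C * h ^+ 2 * I (fun=> 1) by ring.
apply: kernel_integral_le => //.
  apply: (continuous_fun_add (continuous_fun_add _ _) (continuousZl c2)).
    exact: c1.
  by apply: continuousZl; exact: c1.
move=> s /andP[s0 s1].
have t01 : 0 <= 1 - s ^+ 2 <= 1.
  by rewrite subr_ge0 exprn_ile1//= gerBl sqr_ge0.
set t := 1 - s ^+ 2 in t01 *; case/andP: t01 => t0 t1.
have aI v : 0 <= v <= w + m -> m <= rho - v * t <= rho.
  move=> /andP[v0 vm]; rewrite gerBl mulr_ge0// andbT lerBrDr -lerBrDl.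
  apply: (@le_trans _ _ v); first by rewrite ler_piMr.
  by rewrite (le_trans vm)// /m; lra.
have aI1 : m <= rho - w * t <= rho by apply: aI; rewrite ltW// lerDl ltW.
have aI2 : m <= rho - (w + h) * t <= rho.
  by apply: aI; case/andP: whI => -> _; rewrite lerD2l ltW.
have T := taylor_bound df df1 HC aI1 aI2.
have -> : 2 * s * f (rho - (w + h) * t) + -1 * (2 * s * f (rho - w * t)) +
   - h * - (2 * s * t * f1 (rho - w * t)) =
   (2 * s) * (f (rho - (w + h) * t) - f (rho - w * t) -
     (rho - (w + h) * t - (rho - w * t)) * f1 (rho - w * t)) by ring.
rewrite normrM -mulrA; apply: ler_pM => //.
  by rewrite ger0_norm ?mulr_ge0// ler_piMr.
apply: le_trans T _; rewrite ler_wpM2l//.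
have -> : (rho - (w + h) * t - (rho - w * t)) ^+ 2 = h ^+ 2 * t ^+ 2 by ring.
by rewrite ler_piMr ?sqr_ge0// exprn_ile1.
Unshelve. all: by end_near. Qed.

(** The left side is the derivative of [X ^ (2 - alpha) * circle_integral rho (X ^+ 2)] at [x],
    divided by [x ^ (1 - alpha)]. Integration by parts applies with [h s = (1 + s) * f (q s)]:
    [(1 - s) * (1 + s)] restores the weight of the [f1] term, and [h 0 = f (y ^+ 2)] becomes the
    boundary term. *)
Lemma circle_integral_identity (x y : R) : 0 < x -> 0 < y ->
  let rho := x ^+ 2 + y ^+ 2 in
  (2 - alpha) * circle_integral rho (x ^+ 2) +
  2 * x ^+ 2 * I (fun s => - (2 * s * (1 - s ^+ 2) * f1 (rho - x ^+ 2 * (1 - s ^+ 2)))) =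
  2 * (alpha * I (fun s => f (rho - x ^+ 2 * (1 - s ^+ 2))) + f (y ^+ 2)).
Proof.
move=> x0 y0 rho.
pose q (s : R) := rho - x ^+ 2 * (1 - s ^+ 2).
have q0 s : 0 < q s.
  rewrite (_ : q s = (x * s) ^+ 2 + y ^+ 2) ?sumsq_gt0// /q /rho; ring.
have xI : 0 <= x ^+ 2 < rho by rewrite sqr_ge0 ltrDl exprn_gt0.
have cf : continuous (fun s : R => f (q s)) := continuous_circle (derive_profile1 prof) xI.
have cf1 : continuous (fun s : R => f1 (q s)) := continuous_circle (derive_profile2 prof) xI.
have dq (s : R) : is_derive s (1 : R) q (2 * x ^+ 2 * s).
  by apply: is_derive_eq; rewrite /GRing.scale /=; ring.
have dfq (s : R) : is_derive s (1 : R) (fun s => f (q s)) (f1 (q s) * (2 * x ^+ 2 * s)).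
  exact: (is_derive1_comp (derive_profile1 prof (q0 s)) (dq s)).
pose h' s := f (q s) + (1 + s) * (f1 (q s) * (2 * x ^+ 2 * s)).
have dh (s : R) : is_derive s (1 : R) (fun s => (1 + s) * f (q s)) (h' s).
  by apply: is_derive_eq; rewrite /h' /GRing.scale /=; ring.
have ch' : continuous h'.
  move=> s; apply: cvgD; first exact: cf.
  apply: cvgM; first by apply: cvgD; [exact: cvg_cst|exact: cvg_id].
  by apply: cvgM; [exact: cf1|exact: mulrl_continuous].
have := integral_kernel_by_parts alpha_lt1 dh ch'.
rewrite -/(I (fun s => (1 - s) * h' s - (1 - alpha) * ((1 + s) * f (q s)))).
have -> : (fun s => (1 - s) * h' s - (1 - alpha) * ((1 + s) * f (q s))) =
   (fun s => alpha * f (q s) + (- ((2 - alpha) / 2) * (2 * s * f (q s)) +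
     (- x ^+ 2) * - (2 * s * (1 - s ^+ 2) * f1 (q s)))).
  by apply/funext => s; rewrite /h'; field.
have cA : continuous (fun s : R => 2 * s * f (q s)).
  by move=> s; apply: cvgM; [exact: mulrl_continuous|exact: cf].
have cB : continuous (fun s : R => - (2 * s * (1 - s ^+ 2) * f1 (q s))).
  by move=> s; apply: cvgN; apply: cvgM; [exact: continuous_weight|exact: cf1].
rewrite kernel_integralD//; last 2 first.
- exact: continuousZl.
- exact: (continuous_fun_add (continuousZl cA) (continuousZl cB)).
rewrite kernel_integralD//; [|exact: continuousZl|exact: continuousZl].
rewrite !kernel_integralZ//.
have -> : f (q 0) = f (y ^+ 2) by rewrite /q /rho; congr f; ring.
rewrite /circle_integral -/(q _); move: (I _) (I _) (I _) => i1 i2 i3 H.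
lra.
Qed.

Lemma taylor1_caputo_x (x y : R) : 0 < x -> 0 < y ->
  taylor1 (fun phi => caputo_x alpha Psi (rot_x phi x y) (rot_y phi x y)) 0
    (alpha * RL_integral_x alpha (partial_y Psi) x y +
     x `^ (1 - alpha) * partial_y Psi 0 y / Gamma (1 - alpha)).
Proof.
move=> x0 y0; pose rho := x ^+ 2 + y ^+ 2.
pose X phi := rot_x phi x y.
have X0E : X 0 = x by rewrite /X /rot_x cos0 sin0 mul1r mul0r addr0.
have Y0E : rot_y 0 x y = y by rewrite /rot_y cos0 sin0 oppr0 mul0r add0r mul1r.
have cX : {for 0, continuous X}.
  by apply/differentiable_continuous/derivable1_diffP; exact: ex_derive.
have cY : {for 0, continuous (fun phi => rot_y phi x y)}.
  by apply/differentiable_continuous/derivable1_diffP; exact: ex_derive.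
have rhoE phi : X phi ^+ 2 + rot_y phi x y ^+ 2 = rho.
  rewrite /X /rot_x /rot_y /rho -[RHS]mul1r -(cos2Dsin2 phi); ring.
(* The integral formula needs both rotated coordinates positive, hence only small [phi]. The square
   is written as a product to suit [taylor1M]. *)
apply: (@near_eq_taylor1 _ _ (fun phi => (Gamma (1 - alpha))^-1 *
    (X phi `^ (2 - alpha) * circle_integral rho (X phi * X phi)))).
  near=> phi; rewrite add0r caputo_xE ?rhoE ?expr2//.
  - rewrite -/(X phi); near: phi.
    apply: (@cvgr_gt _ _ _ _ X x) => //.
    by move: cX; rewrite /prop_for /continuous_at X0E.
  - near: phi; apply: (@cvgr_gt _ _ _ _ (fun phi => rot_y phi x y) y) => //.
    by move: cY; rewrite /prop_for /continuous_at Y0E.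
have TX : taylor1 X 0 y := taylor1_rot_x x y.
have TA : taylor1 (fun z : R => z `^ (2 - alpha)) (X 0) ((2 - alpha) * x `^ (2 - alpha - 1)).
  by rewrite X0E; exact: taylor1_powR.
have xI : 0 < x ^+ 2 < rho by rewrite exprn_gt0//= ltrDl exprn_gt0.
have TB : taylor1 (circle_integral rho) (X 0 * X 0)
    (I (fun s => - (2 * s * (1 - s ^+ 2) * f1 (rho - x ^+ 2 * (1 - s ^+ 2))))).
  by rewrite X0E -expr2; exact: taylor1_circle_integral.
have := taylor1Z (Gamma (1 - alpha))^-1
  (taylor1M (@taylor1_comp _ (fun z : R => z `^ (2 - alpha)) X 0 _ _ TA TX)
    (@taylor1_comp _ (circle_integral rho) (fun phi => X phi * X phi) 0 _ _ TB
      (taylor1M TX TX))).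
rewrite /= X0E -expr2.
rewrite RL_integral_x_partial_yE// partial_y_radial// -/rho.
congr (taylor1 _ _ _).
have := circle_integral_identity x0 y0; rewrite /= -/rho expr0n /= add0r => H.
have -> : 2 - alpha - 1 = 1 - alpha by ring.
have -> : 2 - alpha = (1 - alpha) + 1 by ring.
rewrite [x `^ (_ + 1)]powRD; last by rewrite (gt_eqF x0) implybT.
rewrite powRr1 ?ltW//.
move: H; set i1 := circle_integral _ _; set i2 := I _; set i3 := I _.
set G := _^-1; set P := x `^ _ => H.
(* The factor [y] is the derivative of [X] at 0; the bracket is the left side of
   [circle_integral_identity]. *)
transitivity (G * P * y * ((2 - alpha) * i1 + 2 * x ^+ 2 * i2)); first by ring.
by rewrite H; ring.
Unshelve. all: by end_near. Qed.

End Caputo.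

Theorem mainTheorem4 (R : realType) (alpha : R) (Psi : R -> R -> R)
    (alpha_gt0 : 0 < alpha) (alpha_lt1 : alpha < 1)
    (Psi_analytic : real_analytic2 Psi) (Psi_inv : rotation_invariant Psi)
    (x y : R) (x_gt0 : 0 < x) (y_gt0 : 0 < y) :
  ((fun phi : R => caputo_x alpha Psi (rot_x phi x y) (rot_y phi x y)) =
   (fun phi : R =>
      caputo_x alpha Psi x y +
      phi * (alpha * RL_integral_x alpha (partial_y Psi) x y +
             x `^ (1 - alpha) * partial_y Psi 0 y / Gamma (1 - alpha)))
   +O_ (0 : R) (fun phi : R => phi ^+ 2)) /\
  ((fun phi : R => caputo_y alpha Psi (rot_x phi x y) (rot_y phi x y)) =
   (fun phi : R =>
      caputo_y alpha Psi x y -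
      phi * (alpha * RL_integral_y alpha (partial_x Psi) x y +
             y `^ (1 - alpha) * partial_x Psi x 0 / Gamma (1 - alpha)))
   +O_ (0 : R) (fun phi : R => phi ^+ 2)).
Proof.
have [F [f [f1 [f2 prof]]]] := radial_profile_exists Psi_analytic Psi_inv.
have rot0 (u v : R) : (rot_x 0 u v = u) * (rot_y 0 u v = v).
  by rewrite /rot_x /rot_y cos0 sin0 oppr0 !mul0r !mul1r addr0 add0r.
split.
  by apply: taylor1_bigO (taylor1_caputo_x alpha_lt1 prof x_gt0 y_gt0) _; rewrite !rot0.
(* Exchanging the coordinates turns [caputo_y] into [caputo_x] by definition and the rotation by
   [phi] into the one by [- phi]. *)
have T := taylor1_caputo_x alpha_lt1 (radial_profile_swap prof) y_gt0 x_gt0.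
have TN : taylor1 (fun phi : R => - phi) 0 (-1).
  exists 0; near=> h; rewrite mul0r.
  by rewrite [X in `|X|](_ : _ = 0) ?normr0//; ring.
(* Composition with [phi |-> - phi] at 0 requires the expansion at the point [- 0]. *)
rewrite -[0]oppr0 in T.
apply: taylor1_bigO.
  have -> : (fun phi => caputo_y alpha Psi (rot_x phi x y) (rot_y phi x y)) =
      (fun phi : R => caputo_x alpha (fun u v => Psi v u) (rot_x (- phi) y x)
        (rot_y (- phi) y x)).
    apply/funext => phi.
    have -> : rot_x (- phi) y x = rot_y phi x y by rewrite /rot_x /rot_y cosN sinN; ring.
    by have -> : rot_y (- phi) y x = rot_x phi x y by rewrite /rot_x /rot_y cosN sinN; ring.
  exact: taylor1_comp T TN.
by apply/funext => phi; rewrite !rot0 mulrN1 mulrN oppr0.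
Unshelve. all: by end_near. Qed.
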